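(* Let $1\le k<n$ and let $\Delta(k,n)=\{x\in[0,1]^n:\sum_{i=1}^n x_i=k\}$. Let $A_1\sqcup A_2\sqcup A_3=[n]$ be a partition and $\mu_1,\mu_2,\mu_3\in\mathbb N$ with $\mu_1+\mu_2+\mu_3=k$ and $1\le\mu_j\le|A_j|-1$ for $j=1,2,3$. Consider the two subdivisions of $\Delta(k,n)$ whose maximal cells are, respectively, $P_1=\{x\in\Delta(k,n):\sum_{i\in A_3}x_i\le\mu_3,\ \sum_{i\in A_2}x_i\ge\mu_2\}$, $P_2=\{x\in\Delta(k,n):\sum_{i\in A_1}x_i\le\mu_1,\ \sum_{i\in A_3}x_i\ge\mu_3\}$, $P_3=\{x\in\Delta(k,n):\sum_{i\in A_2}x_i\le\mu_2,\ \sum_{i\in A_1}x_i\ge\mu_1\}$, and the same three sets with every ''$\le$'' replaced by ''$\ge$'' and vice versa. (These are $3$-splits of $\Delta(k,n)$.) Both of these subdivisions are matroid subdivisions, i.e. every cell of them is a matroid polytope.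
   Context: $[n]=\{1,\dots,n\}$. For a matroid $\mathcal M$ on $[n]$, its matroid polytope is the convex hull of the characteristic vectors in $\mathbb R^n$ of the bases of $\mathcal M$. A subdivision of the polytope $\Delta(k,n)$ is a polyhedral subdivision using only vertices of $\Delta(k,n)$ (the 0/1-vectors with exactly $k$ ones); it is a matroid subdivision if all of its cells are matroid polytopes. A $3$-split of a polytope is a coarsest subdivision (one admitting no non-trivial coarsening other than itself) with exactly $3$ maximal cells having an interior face of codimension $2$. *)

(* Defs.v *)
From HB Require Import structures.
From mathcomp Require Import all_boot all_order all_algebra.
From mathcomp Require Import all_classical reals.

Set Implicit Arguments.
Unset Strict Implicit.
Unset Printing Implicit Defensive.

Import Order.TTheory GRing.Theory Num.Theory.

Local Open Scope classical_set_scope.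
Local Open Scope card_scope.
Local Open Scope ring_scope.

(* The ground set [n] = {1, ..., n} is represented by 'I_n, and R^n by row
   vectors 'rV[R]_n. *)

Record matroid (n : nat) := Matroid {
  bases : {set {set 'I_n}};
  bases_neq0 : bases != finset.set0;
  bases_exchange : forall X Y : {set 'I_n}, X \in bases -> Y \in bases ->
    forall x, x \in X :\: Y ->
      exists2 y, y \in Y :\: X & y |: (X :\ x) \in bases
}.

Section Polytopes.
Variables (R : realType) (n : nat).
Implicit Types (P Q F : set 'rV[R]_n) (Sigma : set (set 'rV[R]_n)).

Definition affine_hull (X : set 'rV[R]_n) : set 'rV[R]_n :=
  [set x | exists (m : nat) (p : 'I_m -> 'rV[R]_n) (a : 'I_m -> R),
     [/\ forall j, X (p j),
         \sum_j a j = 1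
       & x = \sum_j a j *: p j]].

Definition convex_hull (X : set 'rV[R]_n) : set 'rV[R]_n :=
  [set x | exists (m : nat) (p : 'I_m -> 'rV[R]_n) (a : 'I_m -> R),
     [/\ forall j, X (p j),
         forall j, 0 <= a j,
         \sum_j a j = 1
       & x = \sum_j a j *: p j]].

(* The affine hull of P is a translate of a d-dimensional linear subspace,
   given as the row space of B. *)
Definition has_dim P (d : nat) : Prop :=
  exists (x0 : 'rV[R]_n) (B : 'M[R]_(d, n)),
    row_free B /\ affine_hull P = [set x | (x - x0 <= B)%MS].

Definition polytope P : Prop :=
  exists2 X : set 'rV[R]_n, finite_set X & P = convex_hull X.

(* The empty set and P itself are faces of P. *)
Definition face P F : Prop :=
  exists (c : 'rV[R]_n) (b : R),
    (forall x, P x -> \sum_i c 0 i * x 0 i <= b) /\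
    F = P `&` [set x | \sum_i c 0 i * x 0 i = b].

Definition vertex P (v : 'rV[R]_n) : Prop := face P [set v].

Definition boundary P : set 'rV[R]_n :=
  [set x | exists F, [/\ face P F, F <> P & F x]].

(* Cells are nonempty by convention: a subdivision is identified with its set
   of nonempty faces. *)
Definition subdivision P Sigma : Prop :=
  [/\ finite_set Sigma,
      forall C, Sigma C ->
        [/\ polytope C, C !=set0 & forall v, vertex C v -> vertex P v],
      forall C F, Sigma C -> face C F -> F !=set0 -> Sigma F,
      forall C D, Sigma C -> Sigma D ->
        face C (C `&` D) /\ face D (C `&` D)
    & \bigcup_(C in Sigma) C = P].

Definition maximal_cells Sigma : set (set 'rV[R]_n) :=
  [set C | Sigma C /\ forall D, Sigma D -> C `<=` D -> C = D].

Definition face_complex (M : set (set 'rV[R]_n)) : set (set 'rV[R]_n) :=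
  [set F | F !=set0 /\ exists2 P, M P & face P F].

Definition trivial_subdivision P : set (set 'rV[R]_n) := face_complex [set P].

Definition coarsening Sigma' Sigma : Prop :=
  forall C, Sigma C -> exists2 D, Sigma' D & C `<=` D.

Definition coarsest_subdivision P Sigma : Prop :=
  [/\ subdivision P Sigma,
      Sigma <> trivial_subdivision P
    & forall Sigma', subdivision P Sigma' -> coarsening Sigma' Sigma ->
        Sigma' <> trivial_subdivision P -> Sigma' = Sigma].

Definition interior_cell P Sigma F : Prop := Sigma F /\ ~ F `<=` boundary P.

Definition has_codim P F (c : nat) : Prop :=
  exists2 d, has_dim F d & has_dim P (d + c)%N.

Definition three_split P Sigma : Prop :=
  [/\ coarsest_subdivision P Sigma,
      maximal_cells Sigma #= `I_3
    & exists2 F, interior_cell P Sigma F & has_codim P F 2].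

Definition char_vector (B : {set 'I_n}) : 'rV[R]_n :=
  \row_i (i \in B)%:R.

Definition matroid_polytope (M : matroid n) : set 'rV[R]_n :=
  convex_hull [set char_vector B | B in [set` bases M]].

Definition matroid_subdivision P Sigma : Prop :=
  subdivision P Sigma /\
  forall C, Sigma C -> exists M : matroid n, C = matroid_polytope M.

Definition hypersimplex (k : nat) : set 'rV[R]_n :=
  [set x | (forall i, 0 <= x 0 i <= 1) /\ \sum_i x 0 i = k%:R].

End Polytopes.

Arguments hypersimplex : clear implicits.

(* Main.v *)
Require Import Defs.
From HB Require Import structures.
From mathcomp Require Import all_boot all_order all_algebra.
From mathcomp Require Import all_classical reals.
From mathcomp Require Import zify ring lra.

Set Implicit Arguments.
Unset Strict Implicit.
Unset Printing Implicit Defensive.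

Import Order.TTheory GRing.Theory Num.Theory.

Local Open Scope classical_set_scope.
Local Open Scope ring_scope.

(** Write [y_j = x(A_j) - mu_j], so that [y_1 + y_2 + y_3 = 0] on the
    hypersimplex. With indices mod 3, the cell [i] is the preimage of the cone
    [y_(i+2) <= 0 <= y_(i+1)]; these three cones form a complete fan in the
    plane of the [y]'s.

    Cells are integral: a point of a cell with fractional coordinates can be
    moved both ways along some [e_l - e_m], without leaving the cell, until a
    coordinate becomes integral. The 0/1 points of a cell satisfy the symmetric
    basis exchange property, which passes to the maximizers of a linear
    functional; hence all faces of cells are matroid polytopes.

    The subdivision is coarsest: a cell [D] of a coarsening that properly
    contains [cell i] contains, by convexity, a relative interior point of
    another [cell j]; since [D] meets the cell [C] above [cell j] in a face of
    [C], it contains all of [cell j]. Two cells contained in [D] force the third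
    in the same way, so [D] is the whole hypersimplex. *)

(** * Faces of convex sets *)

Section ConvexGeometry.
Variables (R : realType) (n : nat).
Implicit Types (c x z : 'rV[R]_n) (C D F G S X : set 'rV[R]_n).

Definition dot c x : R := \sum_i c 0 i * x 0 i.

Lemma dot_sum c m (a : 'I_m -> R) (p : 'I_m -> 'rV[R]_n) :
  dot c (\sum_j a j *: p j) = \sum_j a j * dot c (p j).
Proof.
rewrite /dot; under eq_bigr do rewrite summxE mulr_sumr.
rewrite exchange_big; apply: eq_bigr => j _; rewrite mulr_sumr.
by apply: eq_bigr => i _; rewrite mxE mulrCA.
Qed.

Lemma dotDr c x z : dot c (x + z) = dot c x + dot c z.
Proof. by rewrite /dot -big_split; apply: eq_bigr => i _; rewrite mxE mulrDr. Qed.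

Lemma dotZr c t x : dot c (t *: x) = t * dot c x.
Proof. by rewrite /dot mulr_sumr; apply: eq_bigr => i _; rewrite mxE mulrCA. Qed.

Lemma dotDl c d x : dot (c + d) x = dot c x + dot d x.
Proof. by rewrite /dot -big_split; apply: eq_bigr => i _; rewrite mxE mulrDl. Qed.

Lemma dotZl t c x : dot (t *: c) x = t * dot c x.
Proof. by rewrite /dot mulr_sumr; apply: eq_bigr => i _; rewrite mxE mulrA. Qed.

Lemma dot0l x : dot 0 x = 0.
Proof. by rewrite /dot big1// => i _; rewrite mxE mul0r. Qed.

Definition convex S := forall m (p : 'I_m -> 'rV[R]_n) (a : 'I_m -> R),
  (forall j, S (p j)) -> (forall j, 0 <= a j) -> \sum_j a j = 1 ->
  S (\sum_j a j *: p j).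

Lemma convex_halfspace c b : convex [set x | dot c x <= b].
Proof.
move=> m p a Sp a0 a1 /=; rewrite dot_sum -[b]mul1r -a1 mulr_suml.
by apply: ler_sum => j _; apply: ler_wpM2l; [exact: a0|exact: Sp].
Qed.

Lemma convex_hull_sub X S : convex S -> X `<=` S -> convex_hull X `<=` S.
Proof.
by move=> cS XS x [m [p [a [Xp a0 a1 ->]]]]; apply: cS => // j; apply: XS.
Qed.

Lemma sub_convex_hull X : X `<=` convex_hull X.
Proof.
move=> x Xx; exists 1%N, (fun=> x), (fun=> 1); split => //.
- by rewrite big_ord1.
- by rewrite big_ord1 scale1r.
Qed.

Lemma convex_hull_neq0 X x : convex_hull X x -> X !=set0.
Proof.
case=> -[|m] [p [a [Xp _ a1 _]]]; last by exists (p ord0).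
by move: a1; rewrite big_ord0 => /esym/eqP; rewrite oner_eq0.
Qed.

Lemma convex_hull_comb X x z t : convex_hull X x -> convex_hull X z ->
  0 <= t <= 1 -> convex_hull X (t *: x + (1 - t) *: z).
Proof.
move=> [m1 [p1 [a1 [Xp1 a10 a11 ->]]]] [m2 [p2 [a2 [Xp2 a20 a21 ->]]]] /andP[t0 t1].
exists (m1 + m2)%N, (fun j => match fintype.split j with inl i => p1 i | inr i => p2 i end),
  (fun j => match fintype.split j with inl i => t * a1 i | inr i => (1 - t) * a2 i end).
have sl i : fintype.split (lshift m2 i) = inl i by exact: (unsplitK (inl i)).
have sr i : fintype.split (rshift m1 i) = inr i by exact: (unsplitK (inr i)).
split.
- by move=> j; case: splitP.
- by move=> j; case: splitP => i _; rewrite mulr_ge0// subr_ge0.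
- rewrite big_split_ord /=.
  under eq_bigr do rewrite sl; under [X in _ + X]eq_bigr do rewrite sr.
  by rewrite -!mulr_sumr a11 a21 !mulr1 addrC subrK.
- rewrite big_split_ord /= !scaler_sumr; congr (_ + _).
  + by apply: eq_bigr => i _; rewrite sl scalerA.
  + by apply: eq_bigr => i _; rewrite sr scalerA.
Qed.

Lemma face_sub C F : face C F -> F `<=` C.
Proof. by case=> c [b [_ ->]] x []. Qed.

Lemma face_refl C : face C C.
Proof.
exists 0, 0; split=> [x _|]; rewrite -?/(dot 0 _) ?dot0l//.
by apply/seteqP; split=> x /=; [rewrite -/(dot 0 _) dot0l|case].
Qed.

Lemma face_restrict C D F : D `<=` C -> face C F -> face D (D `&` F).
Proof.
move=> DC [c [b [cb ->]]]; exists c, b; split=> [x /DC/cb//|].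
by rewrite setIA; congr (_ `&` _); apply/setIidl.
Qed.

(** The weighted sum of the slacks [b - dot c (p j)] vanishes and its terms are nonnegative, so
    every point of positive weight has slack zero. *)
Lemma face_comb C F m (p : 'I_m -> 'rV[R]_n) (a : 'I_m -> R) :
  face C F -> (forall j, C (p j)) -> (forall j, 0 <= a j) -> \sum_j a j = 1 ->
  F (\sum_j a j *: p j) -> forall j, 0 < a j -> F (p j).
Proof.
move=> [c [b [cb ->]]] Cp a0 a1 [_ /= eb] j aj; split => //=.
rewrite -/(dot c _) dot_sum in eb.
have /psumr_eq0P/(_ j isT)/eqP : \sum_j a j * (b - dot c (p j)) = 0.
  under eq_bigr do rewrite mulrBr.
  by rewrite sumrB -mulr_suml a1 mul1r eb subrr.
rewrite mulf_eq0 (gt_eqF aj) subr_eq0 /= => E; apply/esym/eqP/E => l _.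
by rewrite mulr_ge0// subr_ge0; exact/cb.
Qed.

Lemma face_comb2 C F x z t : face C F -> C x -> C z -> 0 < t < 1 ->
  F (t *: x + (1 - t) *: z) -> F x /\ F z.
Proof.
move=> fF Cx Cz /andP[t0 t1].
pose p (j : 'I_2) := if j == 0 then x else z.
pose a (j : 'I_2) : R := if j == 0 then t else 1 - t.
have -> : t *: x + (1 - t) *: z = \sum_j a j *: p j.
  by rewrite big_ord_recr big_ord1.
move=> Fs; have H := face_comb fF _ _ _ Fs.
have a0 j : 0 < a j by rewrite /a; case: ifP; lra.
have {}H j : F (p j).
  apply: H => //.
  - by move=> i; rewrite /p; case: ifP.
  - by move=> i; exact/ltW.
  - by rewrite big_ord_recr big_ord1 /a/=; lra.
by split; [exact: (H 0)|exact: (H 1)].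
Qed.

(** Induction on the number of points: the first is split off and the remaining weights are divided
    by their sum [s]. If they sum to 0, the combination is the first point itself. *)
Lemma convex_convex_hull X : convex (convex_hull X).
Proof.
elim=> [|m IH] p a Sp a0 a1.
  by move: a1; rewrite big_ord0 => /esym/eqP; rewrite oner_eq0.
rewrite big_ord_recl; rewrite big_ord_recl in a1.
have s0 : 0 <= \sum_(i < m) a (lift ord0 i) by apply: sumr_ge0.
have [s1|s1] := eqVneq (\sum_(i < m) a (lift ord0 i)) 0.
  move/psumr_eq0P: (s1) => ai0; rewrite s1 addr0 in a1.
  rewrite big1 ?addr0 ?a1 ?scale1r// => i _.
  by rewrite ai0 ?scale0r.
set s := \sum_(i < m) a (lift ord0 i) in a1 s0 s1 *.
have sE : 1 - a ord0 = s by rewrite -a1; ring.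
have -> : \sum_(i < m) a (lift ord0 i) *: p (lift ord0 i) =
    (1 - a ord0) *: \sum_(i < m) (a (lift ord0 i) / s) *: p (lift ord0 i).
  rewrite sE scaler_sumr; apply: eq_bigr => i _.
  by rewrite scalerA mulrCA divff// mulr1.
apply: convex_hull_comb => //; last by rewrite a0 -subr_ge0 sE.
by apply: IH => [//|i|]; [rewrite divr_ge0|rewrite -mulr_suml divff].
Qed.

Lemma convex_face C F : convex C -> face C F -> convex F.
Proof.
move=> cC fF m p a Fp a0 a1.
have Cp := cC m p a (fun j => face_sub fF (Fp j)) a0 a1.
case: fF Fp => c [b [cb ->]] Fp; split => //=.
rewrite -/(dot c _) dot_sum -[RHS]mul1r -a1 mulr_suml; apply: eq_bigr => j _.
by case: (Fp j) => _ /= <-.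
Qed.

Lemma polytope_convex C : polytope C -> convex C.
Proof. by case=> X _ ->; apply: convex_convex_hull. Qed.

Lemma convex_comb2 C x z t : convex C -> C x -> C z -> 0 <= t <= 1 ->
  C (t *: x + (1 - t) *: z).
Proof.
move=> cC Cx Cz t01.
have : convex_hull C (t *: x + (1 - t) *: z).
  by apply: convex_hull_comb => //; apply: sub_convex_hull.
exact: convex_hull_sub.
Qed.

Lemma face_convex_hull X F :
  face (convex_hull X) F -> F = convex_hull (X `&` F).
Proof.
move=> fF; apply/seteqP; split; last first.
  by apply: convex_hull_sub => [|x []//]; apply: convex_face fF; apply: convex_convex_hull.
move=> x Fx; have [m [p [a [Xp a0 a1 ex]]]] := face_sub fF Fx.
have [j0 aj0] : exists j, 0 < a j.
  apply: contrapT => /forallNP na; have : \sum_j a j = 0.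
    by apply: big1 => j _; apply/eqP; rewrite eq_le a0 leNgt andbT; apply/negP.
  by rewrite a1 => /eqP; rewrite oner_eq0.
have Fp j : 0 < a j -> F (p j).
  rewrite ex in Fx; apply: face_comb fF _ a0 a1 Fx j => i.
  exact/sub_convex_hull.
(* Points of weight 0 may lie outside [F]; they are replaced by [p j0], which lies in [F], without
   changing the sum. *)
exists m, (fun j => if 0 < a j then p j else p j0), a; split => //.
  by move=> j; case: ifPn => aj; split => //; exact: Fp.
rewrite ex; apply: eq_bigr => j _; case: ifPn => //.
rewrite -leNgt => aj; have -> : a j = 0 by apply/le_anti; rewrite aj a0.
by rewrite !scale0r.
Qed.

(* If [F] is cut out by [c] and [G] is cut out of [F] by [c'], then [G] is cut
   out of the whole polytope by [N c + c'] as soon as [N] exceeds every ratio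
   [(c' v - b') / (b - c v)] at the generators [v] outside [F]. *)
Lemma face_trans (I : finType) (p : I -> 'rV[R]_n) (A : pred I) F G :
  let C := convex_hull [set p i | i in [set i | A i]] in
  face C F -> face F G -> face C G.
Proof.
move=> C [c [b [cb ->]]] [d [e [de ->]]].
(* The sum dominates each single ratio. Generators on the hyperplane of [c] contribute 0, since
   division by 0 gives 0. *)
pose N : R := \sum_i `|dot d (p i) - e| / `|b - dot c (p i)|.
have N0 : 0 <= N by apply: sumr_ge0 => i _; rewrite divr_ge0.
have valid x : C x -> N * dot c x + dot d x <= N * b + e.
  rewrite -dotZl -dotDl; move: x; apply: convex_hull_sub.
    exact: convex_halfspace.
  move=> _ [i /= Ai <-]; rewrite dotDl dotZl.
  have Cpi : C (p i) by apply: sub_convex_hull; exists i.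
  have := cb _ Cpi; rewrite -/(dot c _) le_eqVlt => /orP[/eqP E|lt].
    by rewrite E lerD2l; apply: de; split.
  suff : dot d (p i) - e <= N * (b - dot c (p i)) by lra.
  apply: (le_trans (ler_norm _)); rewrite -ler_pdivrMr ?subr_gt0//.
  rewrite /N (bigD1 i)//= [`|b - _|]gtr0_norm ?subr_gt0// lerDl.
  by apply: sumr_ge0 => j _; rewrite divr_ge0.
(* With [N] alone the inequality is valid; the extra copy of [c] makes equality force
   [dot c x = b]. *)
exists ((N + 1) *: c + d), ((N + 1) * b + e); split=> [x Cx|].
  rewrite -/(dot _ _) dotDl dotZl.
  by have := valid x Cx; have := cb x Cx; rewrite -/(dot c x); lra.
apply/seteqP; split=> x /=.
  move=> [[Cx cE] dE]; split=> //.
  by rewrite -/(dot _ _) dotDl dotZl /dot cE dE.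
rewrite -/(dot _ _) dotDl dotZl => -[Cx E].
have vx := valid x Cx; have cx := cb x Cx; rewrite -/(dot c x) in cx.
have cE : dot c x = b by apply/le_anti; rewrite cx/=; lra.
by split=> //; rewrite -/(dot _ _); rewrite cE in E; lra.
Qed.

(** For convex [S] these are the relative interior points: each segment of [S] ending at [z] extends
    beyond [z] within [S]. This form avoids topology and affine hulls. *)
Definition relint S z :=
  S z /\ forall x, S x -> exists2 t, 0 < t & S (z + t *: (z - x)).

(** The point [z] lies strictly between [x] and a point of [S] beyond [z], so a face through [z]
    contains [x]. *)
Lemma face_relint D F S z :
  face D F -> S `<=` D -> relint S z -> F z -> S `<=` F.
Proof.
move=> fF SD [Sz Sz'] Fz x Sx; have [t t0 St] := Sz' x Sx.
have t1 : 0 < 1 + t by lra.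
apply: (proj1 (face_comb2 (x := x) (z := z + t *: (z - x)) (t := t / (1 + t)) fF _ _ _ _)).
- exact: SD.
- exact: SD.
- by rewrite divr_gt0//= ltr_pdivrMr//; lra.
- suff -> : (t / (1 + t)) *: x + (1 - t / (1 + t)) *: (z + t *: (z - x)) = z by [].
  by apply/rowP => i; rewrite !mxE; field; lra.
Qed.

(** The set lies in the fibre of [M] through [z] and contains a short step from [z] in every kernel
    direction, so its affine hull is the whole fibre. *)
Lemma has_dim_kernel m (M : 'M[R]_(n, m)) S z :
  S z -> (forall x, S x -> x *m M = z *m M) ->
  (forall v : 'rV_n, v *m M = 0 -> exists2 t, 0 < t & S (z + t *: v)) ->
  has_dim S (n - \rank M).
Proof.
move=> Sz SM openS; rewrite -mxrank_ker.
exists z, (row_base (kermx M)); split; first exact: row_base_free.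
apply/seteqP; split=> x /=; rewrite eq_row_base sub_kermx mulmxBl subr_eq0.
  move=> [l [p [a [Sp a1 ->]]]]; rewrite mulmx_suml.
  under eq_bigr do rewrite -scalemxAl SM//.
  by rewrite -scaler_suml a1 scale1r.
move/eqP=> xM; have [|t t0 St] := openS (x - z); first by rewrite mulmxBl xM subrr.
(* The point [x] is an affine combination of [z + t (x - z)] and [z], with weights [1/t] and
   [1 - 1/t]. *)
pose p (j : 'I_2) := if j == 0 then z + t *: (x - z) else z.
pose a (j : 'I_2) := if j == 0 then t^-1 else 1 - t^-1.
exists 2, p, a; split.
- by move=> j; rewrite /p; case: ifP.
- by rewrite big_ord_recr big_ord1 /a/=; ring.
- rewrite big_ord_recr big_ord1 /a /p/=.
  by apply/rowP => i; rewrite !mxE; field; rewrite gt_eqF.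
Qed.

Lemma pos_perturb (I : finType) (a b : I -> R) : (forall i, 0 < a i) ->
  exists2 e, 0 < e & forall t, 0 <= t <= e -> forall i, 0 <= a i + t * b i.
Proof.
move=> a0; pose s := \sum_i `|b i| / a i.
have s0 : 0 <= s by apply: sumr_ge0 => i _; rewrite divr_ge0// ltW.
(* Each ratio [|b i| / a i] is at most [s]; adding 1 keeps the denominator positive when all [b i]
   vanish. *)
exists (1 + s)^-1; first by rewrite invr_gt0; lra.
move=> t /andP[t0 te] i.
have ts : t * (1 + s) <= 1 by rewrite -ler_pdivlMr ?div1r//; lra.
have bs : `|b i| / a i <= s.
  by rewrite /s (bigD1 i)//= lerDl sumr_ge0// => j _; rewrite divr_ge0// ltW.
rewrite ler_pdivrMr// in bs.
have tb : t * `|b i| <= t * (s * a i) by apply: ler_wpM2l.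
have := ler_wpM2l t0 (lerNnormlW (lexx `|b i|)); have := ler_wpM2r (ltW (a0 i)) ts.
have := mulr_ge0 t0 (ltW (a0 i)).
by lra.
Qed.

End ConvexGeometry.

(** * Block indices as the cyclic group of order 3 *)

Section CyclicIndices.
Implicit Types i j : 'I_3.

Lemma ord3P i : [\/ i = 0, i = 1 | i = 2].
Proof.
case: i => -[|[|[|//]]] lt3.
- by apply: Or31; apply/val_inj.
- by apply: Or32; apply/val_inj.
- by apply: Or33; apply/val_inj.
Qed.

Lemma ord3_case i j : [\/ j = i, j = i + 1 | j = i + 2].
Proof.
by case: (ord3P i) => ->; case: (ord3P j) => ->;
  do [by apply: Or31; apply/val_inj | by apply: Or32; apply/val_inj |
      by apply: Or33; apply/val_inj].
Qed.

Lemma ord3_add i : [/\ i + 1 + 1 = i + 2, i + 1 + 2 = i, i + 2 + 1 = i & i + 2 + 2 = i + 1].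
Proof. by case: (ord3P i) => ->; split; apply/val_inj. Qed.

Lemma ord3_neq i :
  ((i == i + 1) = false) * ((i == i + 2) = false) * ((i + 1 == i) = false) *
  ((i + 2 == i) = false) * ((i + 1 == i + 2) = false) * ((i + 2 == i + 1) = false).
Proof. by case: (ord3P i) => ->. Qed.

Lemma sum_ord3 (V : nmodType) (f : 'I_3 -> V) i :
  \sum_j f j = f i + f (i + 1) + f (i + 2).
Proof.
have -> : \sum_j f j = f 0 + f 1 + f 2.
  rewrite !big_ord_recr big_ord0 /= add0r.
  by congr (f _ + f _ + f _); apply/val_inj.
case: (ord3P i) => ->; rewrite ?add0r//.
- have -> : 1 + 1 = 2 :> 'I_3 by apply/val_inj.
  by have -> : 1 + 2 = 0 :> 'I_3 by [apply/val_inj]; rewrite -addrA addrC.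
- have -> : 2 + 1 = 0 :> 'I_3 by apply/val_inj.
  by have -> : 2 + 2 = 1 :> 'I_3 by [apply/val_inj]; rewrite addrC addrA.
Qed.

End CyclicIndices.

(** * Bases of the cells *)

Section Exchange.
Variables (n k : nat) (g : 'I_n -> 'I_3) (mu : 'I_3 -> nat).
Implicit Types (i j : 'I_3) (S T X Y : {set 'I_n}).

Definition block j : {set 'I_n} := [set l | g l == j]%SET.

(** The supports of the 0/1 points of [cell i]. *)
Definition cell_bases i : {set {set 'I_n}} :=
  [set S : {set 'I_n} | [&& #|S| == k, #|S :&: block (i + 2)%R| <= mu (i + 2)%R
             & mu (i + 1)%R <= #|S :&: block (i + 1)%R|]]%N%SET.

Lemma card_block i S :
  #|S| = (#|S :&: block i| + #|S :&: block (i + 1)%R| + #|S :&: block (i + 2)%R|)%N.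
Proof.
rewrite -[RHS](sum_ord3 (fun j => #|S :&: block j|)) -sum1_card.
rewrite (partition_big g xpredT)//=; apply: eq_bigr => j _.
by rewrite -sum1_card; apply: eq_bigl => l; rewrite !inE.
Qed.

(** Membership terms are added on both sides, which avoids truncated subtraction. *)
Lemma card_swap X T x y : x \in X -> y \notin X ->
  (#|(y |: (X :\ x)) :&: T| + (x \in T) = #|X :&: T| + (y \in T))%N.
Proof.
move=> xX yX; rewrite [#|X :&: T|](cardsD1 x) [#|_ :&: T|](cardsD1 y).
rewrite !inE eqxx xX /=.
have -> : ((y |: X :\ x) :&: T) :\ y = (X :&: T) :\ x.
  apply/setP => l; rewrite !inE; case: eqVneq => [->|_]/=; last by rewrite andbA.
  by rewrite (negPf yX) andbF.
lia.
Qed.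

(** The dichotomy driving the exchange: a block offers a partner for [x], or it contains at most as
    many elements of [Y] as of [X]. *)
Lemma block_diffP j X Y :
  (exists2 y, y \in Y :\: X & g y = j) \/ (Y :&: block j \subset X).
Proof.
have [|/subsetPn[y]] := boolP (Y :&: block j \subset X); first by right.
by rewrite !inE => /andP[yY /eqP gy] yX; left; exists y; rewrite ?inE ?yX.
Qed.

Lemma block_sub_card j X Y :
  Y :&: block j \subset X -> (#|Y :&: block j| <= #|X :&: block j|)%N.
Proof. by move=> sYX; apply: subset_leq_card; rewrite finset.subsetI sYX finset.subsetIr. Qed.

Lemma block_sub_ltn_card x X Y : x \in X :\: Y ->
  Y :&: block (g x) \subset X -> (#|Y :&: block (g x)| < #|X :&: block (g x)|)%N.
Proof.
rewrite inE => /andP[xY xX] sYX; apply: proper_card; rewrite properE.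
rewrite finset.subsetI sYX finset.subsetIr/=; apply/subsetPn; exists x; rewrite !inE ?xX ?eqxx//.
by rewrite (negPf xY).
Qed.

Lemma cell_bases_symmetric_exchange i X Y x :
  X \in cell_bases i -> Y \in cell_bases i -> x \in X :\: Y ->
  exists2 y, y \in Y :\: X &
    (y |: (X :\ x) \in cell_bases i) && (x |: (Y :\ y) \in cell_bases i).
Proof.
move=> + + xXY; rewrite !inE => /and3P[/eqP Xk Xa Xb] /and3P[/eqP Yk Ya Yb].
have /andP[xY xX] : (x \notin Y) && (x \in X) by move: xXY; rewrite inE.
(* The block bounds for both exchanged sets, written through the blocks of [x] and [y] only. *)
pose ok y := [&& (#|X :&: block (i + 2)%R| + (g y == (i + 2)%R) <= mu (i + 2)%R + (g x == (i + 2)%R)),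
  (mu (i + 1)%R + (g x == (i + 1)%R) <= #|X :&: block (i + 1)%R| + (g y == (i + 1)%R)),
  (#|Y :&: block (i + 2)%R| + (g x == (i + 2)%R) <= mu (i + 2)%R + (g y == (i + 2)%R)) &
  (mu (i + 1)%R + (g y == (i + 1)%R) <= #|Y :&: block (i + 1)%R| + (g x == (i + 1)%R))]%N.
suff [y yYX /and4P[ok1 ok2 ok3 ok4]] : exists2 y, y \in Y :\: X & ok y.
  exists y => //; move: yYX; rewrite inE => /andP[yX yY]; rewrite !inE.
  have := card_swap [set: _]%SET xX yX; have := card_swap [set: _]%SET yY xY.
  have := card_swap (block (i + 2)%R) xX yX; have := card_swap (block (i + 2)%R) yY xY.
  have := card_swap (block (i + 1)%R) xX yX; have := card_swap (block (i + 1)%R) yY xY.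
  rewrite !finset.setIT !inE; lia.
(* A partner from the block of [x] leaves all block counts unchanged. Otherwise [Y] has strictly
   fewer elements than [X] in that block, hence more in another one. *)
have [[y yYX gy]|sYX] := block_diffP (g x) X Y.
  by exists y => //; rewrite /ok gy; lia.
have lx := block_sub_ltn_card xXY sYX.
have eX := card_block i X; have eY := card_block i Y.
have N := ord3_neq i.
have [gx|gx|gx] := ord3_case i (g x); rewrite gx in lx sYX.
(* Here [x] lies in the unconstrained block. A partner from block [i + 2] is safe if [Y] has more
   elements there than [X]; otherwise [Y] has more in block [i + 1], and a partner from there is
   safe. *)
- have [[y yD gy]|/block_sub_card s2] := block_diffP (i + 2) X Y; last first.
    have [[y yD gy]|/block_sub_card s1] := block_diffP (i + 1) X Y; last lia.
    by exists y; rewrite // /ok gx gy eqxx !N; lia.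
  have [l2|l2] := ltnP #|X :&: block (i + 2)%R| #|Y :&: block (i + 2)%R|.
    by exists y; rewrite // /ok gx gy eqxx !N; lia.
  have [[y' yD' gy']|/block_sub_card s1] := block_diffP (i + 1) X Y; last lia.
  by exists y'; rewrite // /ok gx gy' eqxx !N; lia.
(* In the two constrained blocks, the strict inequality [lx] leaves room for moving [x]. A partner
   from the free block [i] is then safe; failing that, [Y] has more elements than [X] in the third
   block, which leaves room there too. *)
- have [[y yD gy]|/block_sub_card s0] := block_diffP i X Y.
    by exists y; rewrite // /ok gx gy !eqxx !N; lia.
  have [[y yD gy]|/block_sub_card s2] := block_diffP (i + 2) X Y; last lia.
  by exists y; rewrite // /ok gx gy !eqxx !N; lia.
- have [[y yD gy]|/block_sub_card s0] := block_diffP i X Y.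
    by exists y; rewrite // /ok gx gy !eqxx !N; lia.
  have [[y yD gy]|/block_sub_card s1] := block_diffP (i + 1) X Y; last lia.
  by exists y; rewrite // /ok gx gy !eqxx !N; lia.
Qed.

End Exchange.

(** * Integrality of the cells *)

Section Cells.
Variables (R : realType) (n k : nat) (g : 'I_n -> 'I_3) (mu : 'I_3 -> nat).
Implicit Types (i j : 'I_3) (l : 'I_n) (S : {set 'I_n}) (x z : 'rV[R]_n).

Let Delta := hypersimplex R n k.

Definition block_sum j x : R := \sum_(l | g l == j) x 0 l.

Definition cell i : set 'rV[R]_n :=
  [set x | [/\ Delta x, block_sum (i + 2) x <= (mu (i + 2))%:R
                      & (mu (i + 1))%:R <= block_sum (i + 1) x]].

Definition block_vec j : 'rV[R]_n := \row_l (g l == j)%:R.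

Lemma block_sum_dot j x : block_sum j x = dot (block_vec j) x.
Proof.
rewrite /block_sum /dot big_mkcond; apply: eq_bigr => l _.
by rewrite mxE; case: ifP; rewrite ?mul1r ?mul0r.
Qed.

Lemma block_sumD j x z : block_sum j (x + z) = block_sum j x + block_sum j z.
Proof. by rewrite !block_sum_dot dotDr. Qed.

Lemma block_sumZ j t x : block_sum j (t *: x) = t * block_sum j x.
Proof. by rewrite !block_sum_dot dotZr. Qed.

Lemma sum_block_sum x : \sum_l x 0 l = \sum_j block_sum j x.
Proof. exact: (partition_big g xpredT). Qed.

Lemma coord_dot x l : x 0 l = dot (delta_mx 0 l) x.
Proof.
rewrite /dot (bigD1 l)//= mxE !eqxx mul1r big1 ?addr0// => m /negPf ml.
by rewrite mxE eqxx ml mul0r.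
Qed.

Lemma sum_dot x : \sum_l x 0 l = dot (const_mx 1) x.
Proof. by apply: eq_bigr => l _; rewrite mxE mul1r. Qed.

Lemma convex_halfspace_ge c b : convex [set x : 'rV[R]_n | b <= dot c x].
Proof.
have -> : [set x | b <= dot c x] = [set x | dot (-1 *: c) x <= - b].
  by apply/seteqP; split=> x /=; rewrite dotZl mulN1r lerN2.
exact: convex_halfspace.
Qed.

Lemma convex_hypersimplex : convex Delta.
Proof.
move=> m p a Sp a0 a1; split=> [l|].
  rewrite !coord_dot; apply/andP; split.
    by apply: convex_halfspace_ge => // j; case: (Sp j) => /(_ l)/andP[]; rewrite coord_dot.
  by apply: convex_halfspace => // j; case: (Sp j) => /(_ l)/andP[_]; rewrite coord_dot.
rewrite sum_dot dot_sum; under eq_bigr do rewrite -sum_dot.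
by under eq_bigr do rewrite (Sp _).2; rewrite -mulr_suml a1 mul1r.
Qed.

Lemma convex_cell i : convex (cell i).
Proof.
move=> m p a Sp a0 a1; split.
- by apply: convex_hypersimplex => // j; case: (Sp j).
- rewrite block_sum_dot; apply: convex_halfspace => // j /=.
  by rewrite -block_sum_dot; case: (Sp j).
- rewrite block_sum_dot; apply: convex_halfspace_ge => // j /=.
  by rewrite -block_sum_dot; case: (Sp j).
Qed.

Lemma block_sum_char j S : block_sum j (char_vector R S) = #|S :&: block g j|%:R.
Proof.
rewrite -sum1_card natr_sum [RHS]big_mkcond/= /block_sum big_mkcond/=.
by apply: eq_bigr => l _; rewrite mxE !inE; case: (g l == j); case: (l \in S).
Qed.

Lemma sum_char S : \sum_l char_vector R S 0 l = #|S|%:R.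
Proof.
rewrite -sum1_card natr_sum [RHS]big_mkcond/=.
by apply: eq_bigr => l _; rewrite mxE; case: (l \in S).
Qed.

Lemma char_vector_cell i S : cell i (char_vector R S) <-> S \in cell_bases k g mu i.
Proof.
rewrite inE -(eqr_nat R) -!(ler_nat R) -!block_sum_char -sum_char; split.
  by move=> [[_ ->] -> ->]; rewrite eqxx.
case/and3P=> /eqP sk sa sb; split=> //; split=> // l.
by rewrite mxE; case: (l \in S); rewrite ?lexx ?ler01.
Qed.

(** The vector itself serves as the functional: on the hypersimplex it equals [k] minus the
    coordinates outside [S]. Value [k] forces these to be 0, and then the coordinates in [S] to be
    1. *)
Lemma vertex_hypersimplex S : #|S| = k -> vertex Delta (char_vector R S).
Proof.
move=> Sk; exists (char_vector R S), k%:R; rewrite -/(dot _).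
have dotS x : dot (char_vector R S) x = \sum_l x 0 l - \sum_(l | l \notin S) x 0 l.
  rewrite [\sum_l x 0 l](bigID (mem S))/= addrK /dot [RHS]big_mkcond/=; apply: eq_bigr => l _.
  by rewrite mxE; case: ifP; rewrite ?mul1r ?mul0r.
split=> [x [x01 xk]|].
  rewrite -/(dot _ x) dotS xk lerBlDr lerDl.
  by apply: sumr_ge0 => l _; case/andP: (x01 l).
apply/seteqP; split=> x /=.
  move=> ->; split.
    split=> [l|]; last by rewrite sum_char Sk.
    by rewrite mxE; case: (l \in S); rewrite ?lexx ?ler01.
  rewrite -/(dot _ _) dotS sum_char Sk big1 ?subr0// => l /negPf lS.
  by rewrite mxE lS.
rewrite -/(dot _ x) => -[[x01 xk] eq].
have s0 : \sum_(l | l \notin S) x 0 l = 0.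
  by move: eq; rewrite dotS xk => /eqP; rewrite subr_eq addrC -subr_eq subrr => /eqP.
have s1 : \sum_(l in S) (1 - x 0 l) = 0.
  rewrite sumrB sumr_const Sk -xk (bigID (mem S))/= s0 addr0 subrr.
  by [].
apply/rowP => l; rewrite mxE; case: (boolP (l \in S)) => lS.
  apply/eqP; rewrite eq_sym -subr_eq0; apply/eqP.
  by apply: (psumr_eq0P _ s1) => // m _; rewrite subr_ge0; case/andP: (x01 m).
by apply: (psumr_eq0P _ s0) => // m _; case/andP: (x01 m).
Qed.

(** * Removing fractional coordinates *)

Definition fractional x l := 0 < x 0 l < 1.
Definition nfrac x := #|[set l | fractional x l]%SET|.
(** The move [x + t (e_l - e_m)], which preserves the coordinate sum. *)
Definition shift x l m (t : R) : 'rV[R]_n :=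
  \row_h (x 0 h + t * ((h == l)%:R - (h == m)%:R)).

Lemma block_sum_shift j x l m t : block_sum j (shift x l m t) =
  block_sum j x + t * ((g l == j)%:R - (g m == j)%:R).
Proof.
have -> : shift x l m t = x + t *: (delta_mx 0 l + -1 *: delta_mx 0 m).
  by apply/rowP => h; rewrite !mxE eqxx/= mulN1r.
rewrite block_sumD block_sumZ block_sumD block_sumZ mulN1r.
have bd h : block_sum j (delta_mx 0 h) = (g h == j)%:R.
  rewrite block_sum_dot /dot (bigD1 h)//= !mxE !eqxx mulr1 big1 ?addr0// => f /negPf fh.
  by rewrite !mxE eqxx fh mulr0.
by rewrite !bd.
Qed.

Lemma integral_sum x (Q : pred 'I_n) :
  (forall l, Q l -> 0 <= x 0 l <= 1 /\ ~~ fractional x l) ->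
  \sum_(l | Q l) x 0 l = (\sum_(l | Q l) (x 0 l == 1)%R)%N%:R.
Proof.
move=> H; rewrite natr_sum; apply: eq_bigr => l /H[/andP[l0 l1]].
rewrite /fractional negb_and -!leNgt => /orP[l0'|l1'].
  by have -> : x 0 l = 0 by [apply/le_anti; rewrite l0' l0]; rewrite eq_sym oner_eq0.
by have -> : x 0 l = 1 by [apply/le_anti; rewrite l1' l1]; rewrite eqxx.
Qed.

(* A block sum with a single fractional entry lies strictly between two
   consecutive integers, so integral bounds do not see that entry. *)
Lemma block_sum_round j x z l : g l = j -> fractional x l -> 0 <= z 0 l <= 1 ->
  (forall h, 0 <= x 0 h <= 1) ->
  (forall h, h != l -> g h = j -> z 0 h = x 0 h /\ ~~ fractional x h) ->
  forall m : nat, (block_sum j x <= m%:R -> block_sum j z <= m%:R) /\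
                  (m%:R <= block_sum j x -> m%:R <= block_sum j z).
Proof.
move=> gl /andP[xl0 xl1] /andP[zl0 zl1] x01 H m.
rewrite /block_sum !(bigD1 l (P := fun l => g l == j)) ?gl//=.
rewrite [X in z 0 l + X](eq_bigr (fun h => x 0 h)); last first.
  by move=> h /andP[/eqP gh hl]; case: (H h hl gh).
rewrite integral_sum; last by move=> h /andP[/eqP gh hl]; case: (H h hl gh).
move: (\sum_(_ | _) _)%N => N; split=> le.
  have : (N < m)%N by rewrite -(ltr_nat R); lra.
  by rewrite -(ler_nat R) -natr1; lra.
have : (m < N.+1)%N by rewrite -(ltr_nat R) -natr1; lra.
by rewrite ltnS -(ler_nat R); lra.
Qed.

(** Two ways in which a move respects integral bounds: within one block no block sum changes, and if
    every block has at most one fractional entry, [block_sum_round] applies. *)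
Definition exchangeable x l m := [/\ l != m, fractional x l, fractional x m
  & g l = g m \/ forall h h', fractional x h -> fractional x h' -> g h = g h' -> h = h'].

Lemma exchangeableC x l m : exchangeable x l m -> exchangeable x m l.
Proof. by case=> lm fl fm H; split=> //; [rewrite eq_sym|case: H => [->|]; [left|right]]. Qed.

Lemma shift_cell i x l m t : exchangeable x l m -> cell i x ->
  0 <= x 0 l + t <= 1 -> 0 <= x 0 m - t <= 1 -> cell i (shift x l m t).
Proof.
move=> [lm fl fm H] [[x01 xk] xa xb] tl tm.
have ml : (m == l) = false by rewrite eq_sym (negPf lm).
have s01 h : 0 <= shift x l m t 0 h <= 1.
  rewrite mxE; case: (eqVneq h l) => [->|hl].
    by rewrite (negPf lm) subr0 mulr1.
  by case: (eqVneq h m) => [->|hm]; rewrite ?subrr ?mulr0 ?addr0 ?x01// sub0r mulrN1.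
have bnd j (u : nat) : (block_sum j x <= u%:R -> block_sum j (shift x l m t) <= u%:R) /\
    (u%:R <= block_sum j x -> u%:R <= block_sum j (shift x l m t)).
  have [glm|glm] := eqVneq (g l) (g m).
    by rewrite block_sum_shift glm subrr mulr0 addr0.
  have {H}H h h' : fractional x h -> fractional x h' -> g h = g h' -> h = h'.
    by case: H => [/eqP|]; [rewrite (negPf glm)|apply].
  have [gl|gl] := eqVneq (g l) j.
    apply: (block_sum_round (l := l)) => // h hl gh; split.
      rewrite mxE (negPf hl); case: eqVneq => [hm|_]; last by rewrite subrr mulr0 addr0.
      by rewrite -hm gh gl eqxx in glm.
    by apply/negP => fh; rewrite (H h l) ?eqxx ?gh ?gl in hl.
  have [gm|gm] := eqVneq (g m) j.
    apply: (block_sum_round (l := m)) => // h hm gh; split.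
      rewrite mxE (negPf hm); case: eqVneq => [hl|_]; last by rewrite subrr mulr0 addr0.
      by rewrite -hl gh eqxx in gl.
    by apply/negP => fh; rewrite (H h m) ?eqxx ?gh ?gm in hm.
  by rewrite block_sum_shift (negPf gl) (negPf gm) subrr mulr0 addr0.
split; [split=> //|exact: (bnd _ _).1|exact: (bnd _ _).2].
rewrite sum_block_sum; under eq_bigr do rewrite block_sum_shift.
rewrite big_split/= -sum_block_sum xk -mulr_sumr sumrB.
have s1 h : \sum_j (g h == j)%:R = 1 :> R.
  by rewrite (bigD1 (g h))//= eqxx big1 ?addr0// => j; rewrite eq_sym => /negPf ->.
by rewrite !s1 subrr mulr0 addr0.
Qed.

Lemma exchange_step i x l m : exchangeable x l m -> cell i x ->
  exists t, [/\ 0 < t, cell i (shift x l m t) & (nfrac (shift x l m t) < nfrac x)%N].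
Proof.
move=> lmx cx; have [lm fl fm _] := lmx.
have [/andP[l0 l1] /andP[m0 m1]] := (fl, fm).
have ml : (m == l) = false by rewrite eq_sym (negPf lm).
(* The largest step that keeps both coordinates in the unit interval: coordinate [l] becomes 1 or
   coordinate [m] becomes 0. *)
exists (Num.min (1 - x 0 l) (x 0 m)); set t := Num.min _ _.
have t0 : 0 < t by rewrite lt_min m0 subr_gt0 l1.
have tl : t <= 1 - x 0 l by rewrite ge_min lexx.
have tm : t <= x 0 m by rewrite ge_min lexx orbT.
split=> //; first by apply: shift_cell => //; apply/andP; split; lra.
have sl : shift x l m t 0 l = x 0 l + t by rewrite mxE eqxx (negPf lm) subr0 mulr1.
have sm : shift x l m t 0 m = x 0 m - t by rewrite mxE eqxx ml sub0r mulrN1.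
apply: proper_card; apply/properP; split.
  apply/fintype.subsetP => h; rewrite !inE.
  case: (eqVneq h l) => [->//|hl]; case: (eqVneq h m) => [->//|hm].
  by rewrite /fractional mxE (negPf hl) (negPf hm) subrr mulr0 addr0.
have [tE|tE] := leP (1 - x 0 l) (x 0 m).
  exists l; rewrite !inE// /fractional sl.
  by rewrite /t (min_idPl tE) addrC subrK ltxx andbF.
exists m; rewrite !inE// /fractional sm.
by rewrite /t (min_idPr (ltW tE)) subrr ltxx.
Qed.

(** A sole fractional coordinate would make the total [k] non-integral, so there are at least two.
    Either some two share a block, or all lie in different blocks. *)
Lemma exchangeable_exists x l : Delta x -> fractional x l ->
  exists h m, exchangeable x h m.
Proof.
move=> [x01 xk] fl.
have [[h [m hm]]|no] := pselect (exists h m, [/\ h != m, fractional x h, fractional x m & g h = g m]).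
  by exists h, m; case: hm => hm fh fm gg; split=> //; left.
have uniq h h' : fractional x h -> fractional x h' -> g h = g h' -> h = h'.
  move=> fh fh' gg; apply/eqP; apply: contrapT => /negP hh'.
  by apply: no; exists h, h'.
have [[m ml fm]|nom] := pselect (exists2 m, m != l & fractional x m).
  by exists m, l; split=> //; right.
exfalso; move: xk; rewrite (bigD1 l)//= integral_sum; last first.
  by move=> h hl; split=> //; apply/negP => fh; apply: nom; exists h.
move: (\sum_(_ | _) _)%N => N xk; case/andP: fl => l0 l1.
have : (N < k)%N by rewrite -(ltr_nat R) -xk; lra.
by rewrite -(ler_nat R) -xk -natr1; lra.
Qed.

Lemma cell_integral i :
  cell i = convex_hull [set char_vector R S | S in [set` cell_bases k g mu i]].
Proof.
apply/seteqP; split; last first.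
  apply: convex_hull_sub; first exact: convex_cell.
  by move=> _ [S /= Si <-]; apply/char_vector_cell.
(* Induction on a bound for the number of fractional coordinates. *)
move=> x; move: {2}(nfrac x) (leqnn (nfrac x)) => N.
elim: N x => [|N IH] x xN cx.
  apply: sub_convex_hull; pose S := [set l | x 0 l == 1]%SET.
  have xS : x = char_vector R S.
    apply/rowP => l; rewrite mxE inE.
    have [x01 _ _] := cx; have {x01}[/(_ l)/andP[l0 l1] _] := x01.
    have : ~~ fractional x l.
      apply/negP => fl; move: xN; rewrite leqn0 cards_eq0 => /eqP/setP/(_ l).
      by rewrite !inE fl.
    rewrite /fractional negb_and -!leNgt => /orP[l0'|l1'].
      by have -> : x 0 l = 0 by [apply/le_anti; rewrite l0' l0]; rewrite eq_sym oner_eq0.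
    by have -> : x 0 l = 1 by [apply/le_anti; rewrite l1' l1]; rewrite eqxx.
  by exists S => //=; apply/char_vector_cell; rewrite -xS.
have [[l fl]|nofrac] := pselect (exists l, fractional x l); last first.
  apply: IH => //; rewrite leqNgt; apply/negP => lt0.
  have /card_gt0P[l] : (0 < nfrac x)%N by apply: leq_trans lt0.
  by rewrite inE => fl; apply: nofrac; exists l.
have [h [m hm]] : exists h m, exchangeable x h m.
  by apply: exchangeable_exists fl; case: cx.
have [t [t0 ct nt]] := exchange_step hm cx.
have [s [s0 cs ns]] := exchange_step (exchangeableC hm) cx.
(* The opposite moves by [t] and [s] lie on either side of [x], whence these weights. *)
have -> : x = (s / (s + t)) *: shift x h m t + (1 - s / (s + t)) *: shift x m h s.
  by apply/rowP => f; rewrite !mxE; field; lra.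
apply: convex_hull_comb.
- by apply: IH ct; rewrite -ltnS; exact: leq_trans nt xN.
- by apply: IH cs; rewrite -ltnS; exact: leq_trans ns xN.
- by rewrite divr_ge0 ?ler_pdivrMr ?mul1r ?lerDl; lra.
Qed.

(** * Faces of the cells as matroid polytopes *)

Lemma dot_swap c (X : {set 'I_n}) l m : l \in X -> m \notin X ->
  dot c (char_vector R (m |: (X :\ l))) = dot c (char_vector R X) + c 0 m - c 0 l.
Proof.
move=> lX mX.
have -> : char_vector R (m |: (X :\ l)) = char_vector R X + (delta_mx 0 m + -1 *: delta_mx 0 l).
  apply/rowP => h; rewrite !mxE !inE !eqxx /= mulN1r.
  case: (eqVneq h m) => [->|hm]/=.
    rewrite (negPf mX) add0r; case: eqVneq => [ml|_]; last by rewrite subr0.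
    by rewrite ml lX in mX.
  by case: (eqVneq h l) => [->|hl]/=; rewrite ?lX ?subrr ?addr0// add0r subrr.
have dd h : dot c (delta_mx 0 h) = c 0 h.
  rewrite /dot (bigD1 h)//= mxE !eqxx mulr1 big1 ?addr0// => f /negPf fh.
  by rewrite mxE eqxx fh mulr0.
by rewrite !dotDr dotZr !dd; ring.
Qed.

(* Both sets produced by a symmetric exchange are bases and their weights add
   up to twice the maximum, so both have maximal weight. *)
Lemma cell_face_matroid i F : face (cell i) F -> F !=set0 ->
  exists M : matroid n, F = matroid_polytope M.
Proof.
move=> fF F0; have [c [b [cb eF]]] := fF.
pose B := [set S in cell_bases k g mu i | dot c (char_vector R S) == b]%SET.
have FE : F = convex_hull [set char_vector R S | S in [set` B]].
  rewrite {1}cell_integral in fF; rewrite (face_convex_hull fF); congr convex_hull.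
  apply/seteqP; split=> x.
    move=> [[S /= Si <-]]; rewrite eF => -[_ /= Sb]; exists S => //=.
    by rewrite inE Si; apply/eqP.
  move=> [S /= + <-]; rewrite inE => /andP[Si /eqP Sb]; split; first by exists S.
  by rewrite eF; split=> //; apply/char_vector_cell.
have Bn0 : B != finset.set0.
  case: F0 => x; rewrite FE => /convex_hull_neq0[_ [S /= SB _]].
  by apply/set0Pn; exists S.
have Bex X Y : X \in B -> Y \in B -> forall x : 'I_n, x \in X :\: Y ->
    exists2 y, y \in Y :\: X & y |: (X :\ x) \in B.
  rewrite [X \in B]inE [Y \in B]inE => /andP[Xi /eqP Xb] /andP[Yi /eqP Yb] x xXY.
  have [y yYX /andP[X'i Y'i]] := cell_bases_symmetric_exchange Xi Yi xXY.
  exists y => //; rewrite inE X'i/=; move: xXY yYX; rewrite !inE.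
  move=> /andP[xY xX] /andP[yX yY].
  have := cb _ (proj2 (char_vector_cell _ _) X'i).
  have := cb _ (proj2 (char_vector_cell _ _) Y'i).
  rewrite -!/(dot c _) !dot_swap// Xb Yb => h1 h2.
  by apply/eqP; lra.
by exists (Matroid Bn0 Bex).
Qed.

End Cells.

(** * The subdivision *)

Section ThreeSplit.
Variables (R : realType) (n k : nat) (g : 'I_n -> 'I_3) (mu : 'I_3 -> nat).
Hypothesis sum_mu : (\sum_j mu j)%N = k.
Hypothesis mu_bounds : forall j, (0 < mu j < #|block g j|)%N.
Implicit Types (i j : 'I_3) (l : 'I_n) (x z v : 'rV[R]_n) (C D F : set 'rV[R]_n).

Let Delta := hypersimplex R n k.
Let cells i := cell (R := R) k g mu i.
Let bs j x := block_sum g j x.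
Let m j : R := (mu j)%:R.
Let Sigma := face_complex (range cells).

(** The relation [y_1 + y_2 + y_3 = 0], listed from index [i] on for linear arithmetic. *)
Lemma hypersimplex_sum i x : \sum_l x 0 l = k%:R ->
  bs i x + bs (i + 1) x + bs (i + 2) x = m i + m (i + 1) + m (i + 2).
Proof.
rewrite (sum_block_sum g) (sum_ord3 _ i) => ->.
by rewrite -sum_mu natr_sum (sum_ord3 _ i).
Qed.

(** * Covering by the three cells and their pairwise intersections *)

Lemma cell_sub i : cells i `<=` Delta.
Proof. by move=> x []. Qed.

Lemma cell1E i x : cells (i + 1) x <->
  [/\ Delta x, bs i x <= m i & m (i + 2) <= bs (i + 2) x].
Proof. by rewrite /cells /cell/=; have [-> -> _ _] := ord3_add i. Qed.

Lemma cell2E i x : cells (i + 2) x <->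
  [/\ Delta x, bs (i + 1) x <= m (i + 1) & m i <= bs i x].
Proof. by rewrite /cells /cell/=; have [_ _ -> ->] := ord3_add i. Qed.

Lemma cell_cover i x : Delta x -> [\/ cells i x, cells (i + 1) x | cells (i + 2) x].
Proof.
move=> Dx; have := hypersimplex_sum i (proj2 Dx).
have [h2|h2] := leP (bs (i + 2) x) (m (i + 2)).
  have [h1|h1] := leP (m (i + 1)) (bs (i + 1) x); first by move=> _; apply: Or31.
  by move=> s; apply: Or33; apply/cell2E; split=> //; lra.
have [h0|h0] := leP (bs i x) (m i).
  by move=> _; apply: Or32; apply/cell1E; split=> //; lra.
by move=> s; apply: Or33; apply/cell2E; split=> //; lra.
Qed.

(** Two distinct cells share a bound with opposite signs: [y_(i+2)] for [i] and [i + 1], [y_(i+1)]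
    for [i] and [i + 2]. They meet where it is tight, the other inequalities following from the zero
    sum. *)
Lemma cell_meet_face i j : face (cells i) (cells i `&` cells j).
Proof.
have [->|->|->] := ord3_case i j.
- by rewrite setIid; apply: face_refl.
- exists (block_vec R g (i + 2)), (m (i + 2)); split.
    by move=> x [_ h _]; rewrite -/(dot _ x) -block_sum_dot.
  apply/seteqP; split=> x /=; rewrite -/(dot _ x) -block_sum_dot.
    move=> [cx /cell1E[_ h0 h2]]; split=> //; case: cx => _ h2' _.
    by apply/le_anti; rewrite h2' h2.
  move=> [cx E]; split=> //; case: cx => Dx h2 h1; apply/cell1E.
  have := hypersimplex_sum i (proj2 Dx); rewrite /bs E /m => s.
  by split=> //; rewrite /m /bs; lra.
- exists (-1 *: block_vec R g (i + 1)), (- m (i + 1)); split.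
    by move=> x [_ _ h]; rewrite -/(dot _ x) dotZl -block_sum_dot mulN1r lerN2.
  apply/seteqP; split=> x /=; rewrite -/(dot _ x) dotZl -block_sum_dot mulN1r.
    move=> [cx /cell2E[_ h1 h0]]; split=> //; case: cx => _ _ h1'.
    by congr (- _); apply/le_anti; rewrite h1' h1.
  move=> [cx /oppr_inj E]; split=> //; case: cx => Dx h2 h1; apply/cell2E.
  have := hypersimplex_sum i (proj2 Dx); rewrite /bs E /m => s.
  by split=> //; rewrite /m /bs; lra.
Qed.

(** * Points constant on each block, with prescribed block sums *)

Definition block_point (d : 'I_3 -> R) : 'rV[R]_n :=
  \row_l ((m (g l) + d (g l)) / #|block g (g l)|%:R).

Definition open_coords x := forall l, 0 < x 0 l < 1.

Lemma block_card_gt0 j : 0 < #|block g j|%:R :> R.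
Proof. by rewrite ltr0n; case/andP: (mu_bounds j) => _; apply: leq_ltn_trans. Qed.

Lemma block_sum_point d j : bs j (block_point d) = m j + d j.
Proof.
rewrite /bs /block_sum.
rewrite (eq_bigr (fun=> (m j + d j) / #|block g j|%:R)); last first.
  by move=> l /eqP <-; rewrite mxE.
rewrite sumr_const.
have -> : #|(fun l => g l == j)| = #|block g j| by apply: eq_card => l; rewrite !inE.
by rewrite -[_ *+ _]mulr_natr divfK// gt_eqF// block_card_gt0.
Qed.

(** Since [mu j] is at least 1 and at most [#|block g j| - 1], changing it by less than 1 keeps the
    block average strictly between 0 and 1. *)
Lemma block_point_open d : (forall j, `|d j| < 1) -> open_coords (block_point d).
Proof.
move=> d1 l; rewrite mxE; set j := g l; have := d1 j; rewrite ltr_norml => /andP[d0 {}d1].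
have := mu_bounds j; rewrite -!(ltr_nat R) => /andP[mu0 mu1].
have mu0' : 1 <= m j by rewrite ler1n -(ltr_nat R).
have mu1' : m j + 1 <= #|block g j|%:R by rewrite natr1 ler_nat -(ltr_nat R).
rewrite divr_gt0 ?block_card_gt0//=; last by lra.
by rewrite ltr_pdivrMr ?block_card_gt0// mul1r; lra.
Qed.

Lemma block_point_hypersimplex d : (forall j, `|d j| < 1) -> \sum_j d j = 0 ->
  Delta (block_point d).
Proof.
move=> d1 d0; split=> [l|].
  by have /andP[/ltW-> /ltW->] := block_point_open d1 l.
rewrite (sum_block_sum g); under eq_bigr do rewrite -/(bs _ _) block_sum_point.
by rewrite big_split/= d0 addr0 -natr_sum sum_mu.
Qed.

Definition center := block_point (fun=> 0).

Lemma center_open : open_coords center.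
Proof. by apply: block_point_open => j; rewrite normr0. Qed.

Lemma center_hypersimplex : Delta center.
Proof. by apply: block_point_hypersimplex => [j|]; rewrite ?normr0// big1. Qed.

Lemma block_sum_center j : bs j center = m j.
Proof. by rewrite block_sum_point addr0. Qed.

(* A point in the relative interior of the common facet of the cells [i] and
   [i + 1]. *)
Definition wall_point i :=
  block_point (fun j => ((j == i + 1)%:R - (j == i)%:R) / 2).

Lemma wall_shift_lt1 i j : `|((j == i + 1)%:R - (j == i)%:R) / 2 : R| < 1.
Proof. by rewrite ltr_norml; case: eqP => _; case: eqP => _ /=; apply/andP; split; lra. Qed.

Lemma wall_point_open i : open_coords (wall_point i).
Proof. by apply: block_point_open => j; apply: wall_shift_lt1. Qed.

Lemma wall_point_hypersimplex i : Delta (wall_point i).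
Proof.
apply: block_point_hypersimplex => [j|]; first exact: wall_shift_lt1.
by rewrite (sum_ord3 _ i) !eqxx !ord3_neq; lra.
Qed.

Lemma wall_point_sums i : [/\ bs i (wall_point i) = m i - 2^-1,
  bs (i + 1) (wall_point i) = m (i + 1) + 2^-1 & bs (i + 2) (wall_point i) = m (i + 2)].
Proof.
by rewrite /wall_point; split; rewrite block_sum_point ?eqxx !ord3_neq /=; lra.
Qed.

Lemma wall_point_cell i : cells i (wall_point i) /\ cells (i + 1) (wall_point i).
Proof.
have D := wall_point_hypersimplex i; have [s0 s1 s2] := wall_point_sums i.
split; first by split=> //; rewrite -/(bs _ _) ?s1 ?s2 /m; lra.
by apply/cell1E; split=> //; rewrite ?s0 ?s2; lra.
Qed.

(** * Relative interiors of the hypersimplex and of the cells *)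

Lemma hypersimplex_open x v : open_coords x -> Delta x -> \sum_l v 0 l = 0 ->
  exists2 e, 0 < e & forall t, 0 <= t <= e -> Delta (x + t *: v).
Proof.
move=> x01 Dx v0.
have [|e1 e10 H1] := @pos_perturb R _ (fun l => x 0 l) (fun l => v 0 l).
  by move=> l; case/andP: (x01 l).
have [|e2 e20 H2] := @pos_perturb R _ (fun l => 1 - x 0 l) (fun l => - v 0 l).
  by move=> l; rewrite subr_gt0; case/andP: (x01 l).
exists (Num.min e1 e2); first by rewrite lt_min e10.
move=> t /andP[t0]; rewrite le_min => /andP[te1 te2]; split=> [l|].
  have := H1 t _ l; have := H2 t _ l; rewrite t0 te1 te2 => /(_ isT) h2 /(_ isT) h1.
  by rewrite !mxE h1/=; lra.
rewrite sum_dot dotDr dotZr -!sum_dot v0 mulr0 addr0.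
by case: Dx.
Qed.

Lemma hypersimplex_relint x : open_coords x -> Delta x -> relint Delta x.
Proof.
move=> x01 Dx; split=> // z Dz.
have [|e e0 H] := @hypersimplex_open x (x - z) x01 Dx.
  under eq_bigr do rewrite !mxE.
  by rewrite sumrB (proj2 Dx) (proj2 Dz) subrr.
by exists e => //; apply: H; rewrite lexx ltW.
Qed.

Definition cell_interior i x := [/\ open_coords x, Delta x,
  bs (i + 2) x < m (i + 2) & m (i + 1) < bs (i + 1) x].

Lemma cell_interior_cell i x : cell_interior i x -> cells i x.
Proof. by case=> _ Dx h2 h1; split=> //; exact: ltW. Qed.

Lemma cell_relint i x : cell_interior i x -> relint (cells i) x.
Proof.
move=> ix; split=> [|z cz]; first exact: cell_interior_cell.
have [x01 Dx h2 h1] := ix; have Dz := cell_sub cz.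
have [|e e0 H] := @hypersimplex_open x (x - z) x01 Dx.
  under eq_bigr do rewrite !mxE.
  by rewrite sumrB (proj2 Dx) (proj2 Dz) subrr.
(* The booleans index the slacks of the two block inequalities and their rates of change along
   [x - z]. *)
pose a (b : bool) := if b then m (i + 2) - bs (i + 2) x else bs (i + 1) x - m (i + 1).
pose d (b : bool) := if b then - bs (i + 2) (x - z) else bs (i + 1) (x - z).
have [|e' e'0 H'] := @pos_perturb R _ a d.
  by case; rewrite /a subr_gt0.
have t0 : 0 < Num.min e e' by rewrite lt_min e0.
exists (Num.min e e') => //.
have te : 0 <= Num.min e e' <= e by rewrite (ltW t0) ge_min lexx.
have te' : 0 <= Num.min e e' <= e' by rewrite (ltW t0) ge_min lexx orbT.
have := H' _ te' true; have := H' _ te' false; rewrite /a /d => k1 k2.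
split; first exact: H.
  by rewrite block_sumD block_sumZ; move: k2; rewrite /bs /m; lra.
by rewrite block_sumD block_sumZ; move: k1; rewrite /bs /m; lra.
Qed.

Lemma block_sum_mid j x z : bs j (2^-1 *: x + (1 - 2^-1) *: z) = (bs j x + bs j z) / 2.
Proof. by rewrite /bs block_sumD !block_sumZ; lra. Qed.

Lemma half_itv : 0 <= (2^-1 : R) <= 1. Proof. by apply/andP; split; lra. Qed.

Lemma open_coords_mid x z : Delta x -> Delta z -> open_coords z ->
  open_coords (2^-1 *: x + (1 - 2^-1) *: z) /\ Delta (2^-1 *: x + (1 - 2^-1) *: z).
Proof.
move=> Dx Dz z01; split; last first.
  by apply: convex_comb2 => //; [exact: convex_hypersimplex|exact: half_itv].
move=> l; rewrite !mxE; have /andP[z0 z1] := z01 l; have [/(_ l)/andP[x0 x1] _] := Dx.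
by apply/andP; split; lra.
Qed.

(** The two points lie on the two different walls of cell [i]; their midpoint has [y_(i+1) = 1/4]
    and [y_(i+2) = -1/4]. *)
Lemma mid_walls_interior i :
  cell_interior i (2^-1 *: wall_point i + (1 - 2^-1) *: wall_point (i + 2)).
Proof.
have [O D] := open_coords_mid (wall_point_hypersimplex i)
  (wall_point_hypersimplex (i + 2)) (@wall_point_open (i + 2)).
have [s0 s1 s2] := wall_point_sums i; have [s0' s1' s2'] := wall_point_sums (i + 2).
have [_ _ E1 E2] := ord3_add i; rewrite E1 in s1'; rewrite E2 in s2'.
by split=> //; rewrite block_sum_mid ?s0' ?s2' ?s1 ?s2; lra.
Qed.

Lemma cell_neq0 i : cells i !=set0.
Proof. by exists (wall_point i); case: (wall_point_cell i). Qed.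

Lemma Sigma_cell i : Sigma (cells i).
Proof. by split; [exact: cell_neq0|exists (cells i); [exists i|exact: face_refl]]. Qed.

Lemma cell_subset_eq i j : cells i `<=` cells j -> j = i.
Proof.
move=> /(_ _ (cell_interior_cell (mid_walls_interior i))).
have [_ _ h2 h1] := mid_walls_interior i.
have [->//|->|->] := ord3_case i j.
- by move=> /cell1E[_ _ h]; exfalso; lra.
- by move=> /cell2E[_ h _]; exfalso; lra.
Qed.

Lemma cell_face_trans i F G : face (cells i) F -> face F G -> face (cells i) G.
Proof. by rewrite /cells cell_integral; exact: face_trans. Qed.

(** * The face complex of the cells is a nontrivial subdivision *)

Lemma Sigma_subdivision : subdivision Delta Sigma.
Proof.
split.
(* Each cell is spanned by the characteristic vectors of a family of subsets of the ground set, and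
   there are finitely many families. *)
- apply: (@sub_finite_set _ _ [set convex_hull [set char_vector R S | S in [set` B]] | B in [set: {set {set 'I_n}}]]).
    move=> F [F0 [_ [i _ <-] fF]].
    have [M ->] := cell_face_matroid fF F0.
    by exists (bases M).
  exact/finite_image/finite_finset.
- move=> C [C0 [_ [i _ <-] fC]]; split=> //.
    have [M ->] := cell_face_matroid fC C0.
    exists [set char_vector R S | S in [set` bases M]] => //.
    exact/finite_image/finite_finset.
  (* A one-point face is the hull of the generators in it, so [v] is the characteristic vector of a
     [k]-set. *)
  move=> v fv; have := fC; rewrite {1}/cells cell_integral => /face_convex_hull CE.
  rewrite CE in fv; have /face_convex_hull E := fv.
  have : [set v] v by []; rewrite E => /convex_hull_neq0[z [[[S /= Si <-] _] <-]].
  apply: vertex_hypersimplex; move: Si; rewrite inE.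
  by case/and3P => /eqP.
- move=> C F [C0 [_ [i _ <-] fC]] fF F0; split=> //; exists (cells i); first by exists i.
  exact: cell_face_trans fC fF.
- have H C D : Sigma C -> Sigma D -> face C (C `&` D).
    move=> [C0 [_ [i _ <-] fC]] [D0 [_ [j _ <-] fD]].
    (* In this form the intersection is the restriction to [C] of a face of [cells i], obtained by
       transitivity from the face common to both cells. *)
    have -> : C `&` D = C `&` ((cells i `&` cells j) `&` D).
      apply/seteqP; split=> x [Cx]; last by case.
      by move=> Dx; split=> //; split=> //; split; [apply: (face_sub fC)|apply: (face_sub fD)].
    apply: (face_restrict (face_sub fC)).
    have fI := cell_meet_face i j.
    have fI' : face (cells i `&` cells j) (cells i `&` cells j `&` D).
      by apply: face_restrict fD; apply: subIsetr.
    exact: cell_face_trans fI fI'.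
  by move=> C D SC SD; split; [exact: H|rewrite setIC; exact: H].
- apply/seteqP; split=> x.
    by move=> [C [_ [_ [i _ <-] fC]] Cx]; apply/(@cell_sub i)/(face_sub fC).
  by move=> Dx; case: (cell_cover 0 Dx) => cx; eexists; try exact: cx; apply: Sigma_cell.
Qed.

Lemma maximal_cells_Sigma : maximal_cells Sigma = range cells.
Proof.
apply/seteqP; split=> C.
  move=> [[C0 [_ [i _ <-] fC]] maxC]; exists i => //.
  by apply/esym/maxC; [exact: Sigma_cell|exact: (face_sub fC)].
move=> [i _ <-]; split=> [|D [D0 [_ [j _ <-] fD]] CD]; first exact: Sigma_cell.
have /cell_subset_eq ji : cells i `<=` cells j by move=> x /CD/(face_sub fD).
by apply/seteqP; split=> //; rewrite -ji; apply: face_sub.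
Qed.

(** If the hypersimplex were a cell, some [cells j] would contain both [cells 0] and [cells 1],
    giving [j = 0] and [j = 1]. *)
Lemma Sigma_nontrivial : Sigma <> trivial_subdivision Delta.
Proof.
move=> E; have : Sigma Delta.
  rewrite E; split; first by exists center; exact: center_hypersimplex.
  by exists Delta => //; apply: face_refl.
move=> [_ [_ [j _ <-] /face_sub DC]].
have s i : cells i `<=` cells j by move=> x /cell_sub/DC.
by have := cell_subset_eq (s 0); rewrite (cell_subset_eq (s 1)).
Qed.

(** * No coarsening other than the trivial one and the subdivision itself *)

Section Coarsest.
Variable Sigma' : set (set 'rV[R]_n).
Hypothesis subdiv : subdivision Delta Sigma'.
Hypothesis coarse : coarsening Sigma' Sigma.

Lemma coarse_sub D : Sigma' D -> D `<=` Delta.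
Proof. by case: subdiv => _ _ _ _ <- SD x Dx; exists D. Qed.

Lemma coarse_convex D : Sigma' D -> convex D.
Proof. by case: subdiv => _ H _ _ _ /H[pD _ _]; exact: polytope_convex. Qed.

Lemma coarse_absorb D i z : Sigma' D -> D z -> cell_interior i z -> cells i `<=` D.
Proof.
move=> SD Dz iz; have [C SC iC] := coarse (Sigma_cell i).
case: subdiv => _ _ _ /(_ C D SC SD)[fI _] _.
have : cells i `<=` C `&` D.
  apply: (face_relint fI iC (cell_relint iz)); split=> //.
  exact/iC/cell_interior_cell.
by move=> H x /H[].
Qed.

Lemma coarse_absorb_third D i : Sigma' D ->
  cells (i + 1) `<=` D -> cells (i + 2) `<=` D -> cells i `<=` D.
Proof.
move=> SD D1 D2; apply: coarse_absorb (mid_walls_interior i) => //.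
apply: convex_comb2; [exact: coarse_convex| | |exact: half_itv].
- by apply: D1; case: (wall_point_cell i).
- by apply: D2; case: (wall_point_cell (i + 2)).
Qed.

Lemma coarse_grow D i : Sigma' D -> cells i `<=` D -> D <> cells i -> D = Delta.
Proof.
move=> SD iD Di.
have [x Dx nx] : exists2 x, D x & ~ cells i x.
  apply: contrapT => no; apply: Di; apply/seteqP; split=> // x Dx.
  by apply: contrapT => nx; apply: no; exists x.
have DDx := coarse_sub SD Dx.
have sx := hypersimplex_sum i (proj2 DDx).
have [E1 E2 E3 E4] := ord3_add i.
have mid z : D z -> D (2^-1 *: x + (1 - 2^-1) *: z).
  by move=> Dz; apply: convex_comb2 => //; [exact: coarse_convex|exact: half_itv].
have [//|c1|c2] := cell_cover i DDx.
- have c1D : cells (i + 1) `<=` D.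
    have w := wall_point_cell i; have [s0 s1 s2] := wall_point_sums i.
    (* Averaging [x] with a point of the wall between the cells [i] and [i + 1] makes [y_i]
       negative. *)
    apply: (@coarse_absorb D (i + 1) (2^-1 *: x + (1 - 2^-1) *: wall_point i)) => //.
      by apply: mid; apply: iD; case: w.
    have [O Dm] := open_coords_mid DDx (wall_point_hypersimplex i) (@wall_point_open i).
    have /cell1E[_ h0 h2] := c1.
    split=> //; rewrite ?E1 ?E2 block_sum_mid ?s0 ?s2; first by lra.
    (* If [y_(i+2)] were 0 at [x], the zero sum would put [x] in cell [i]. *)
    suff : m (i + 2) < bs (i + 2) x by lra.
    rewrite lt_neqAle h2 andbT; apply/negP => /eqP eq2; apply: nx; split=> //.
      by rewrite -/(bs _ _) -eq2.
    by rewrite -/(bs _ _) -/(m _); lra.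
  have c2D : cells (i + 2) `<=` D.
    by apply: coarse_absorb_third => //; rewrite ?E3 ?E4.
  apply/seteqP; split; first exact: coarse_sub.
  by move=> z /(cell_cover i)[/iD|/c1D|/c2D].
- have c2D : cells (i + 2) `<=` D.
    have w := wall_point_cell (i + 2); have [s0 s1 s2] := wall_point_sums (i + 2).
    rewrite E3 in s1; rewrite E4 in s2; rewrite E3 in w.
    apply: (@coarse_absorb D (i + 2) (2^-1 *: x + (1 - 2^-1) *: wall_point (i + 2))) => //.
      by apply: mid; apply: iD; case: w.
    have [O Dm] := open_coords_mid DDx (wall_point_hypersimplex (i + 2)) (@wall_point_open (i + 2)).
    have /cell2E[_ h1 h0] := c2.
    split=> //; rewrite ?E3 ?E4 block_sum_mid ?s1 ?s2; last by lra.
    suff : bs (i + 1) x < m (i + 1) by lra.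
    rewrite lt_neqAle h1 andbT; apply/negP => /eqP eq1; apply: nx; split=> //.
      by rewrite -/(bs _ _) -/(m _); lra.
    by rewrite -/(bs _ _) eq1.
  have c1D : cells (i + 1) `<=` D.
    by apply: coarse_absorb_third => //; rewrite ?E1 ?E2.
  apply/seteqP; split; first exact: coarse_sub.
  by move=> z /(cell_cover i)[/iD|/c1D|/c2D].
Qed.

(** Every cell meets the cell [Delta] in a face of [Delta], and that intersection is the cell
    itself. *)
Lemma coarse_trivial : Sigma' Delta -> Sigma' = trivial_subdivision Delta.
Proof.
move=> SD; case: (subdiv) => _ H cl meet _; apply/seteqP; split=> C.
  move=> SC; have [_ C0 _] := H _ SC; split=> //; exists Delta => //.
  have [_] := meet C Delta SC SD; rewrite (_ : C `&` Delta = C)//.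
  exact/setIidl/coarse_sub.
by move=> [C0 [_ -> fC]]; exact: cl fC C0.
Qed.

(* Three proper faces do not cover a convex set: an average of points missing
   one face each misses them all. *)
Lemma coarse_eq : Sigma' <> trivial_subdivision Delta -> Sigma' = Sigma.
Proof.
move=> nt; have nD : ~ Sigma' Delta by move/coarse_trivial.
(* A cell of the coarsening above [cells i] equals it, since otherwise it would grow to [Delta]. *)
have Sc i : Sigma' (cells i).
  have [D SD iD] := coarse (Sigma_cell i).
  have [<-//|ne] := pselect (D = cells i).
  by case: nD; rewrite -(coarse_grow SD iD ne).
case: (subdiv) => _ H cl meet _; apply/seteqP; split=> C; last first.
  by move=> [C0 [_ [i _ <-] fC]]; exact: cl fC C0.
move=> SC; have [_ C0 _] := H _ SC; split=> //.
have [i Ci] : exists i, C `<=` cells i.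
  apply: contrapT => no.
  have miss i : exists2 x, C x & ~ cells i x.
    apply: contrapT => no'; apply: no; exists i => x Cx.
    by apply: contrapT => nx; apply: no'; exists x.
  have [x0 C0' n0] := miss 0; have [x1 C1 n1] := miss (0 + 1).
  have [x2 C2 n2] := miss (0 + 2).
  have Cy := convex_comb2 (coarse_convex SC) C0' C1 half_itv.
  have Cz := convex_comb2 (coarse_convex SC) Cy C2 half_itv.
  have half : 0 < (2^-1 : R) < 1 by apply/andP; split; lra.
  have split3 i : cells i (2^-1 *: (2^-1 *: x0 + (1 - 2^-1) *: x1) + (1 - 2^-1) *: x2) ->
      [/\ cells i x0, cells i x1 & cells i x2].
    move=> iz; have [fi _] := meet C (cells i) SC (Sc i).
    have [iy [_ i2]] := face_comb2 fi Cy C2 half (conj Cz iz).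
    by have [[_ i0] [_ i1]] := face_comb2 fi C0' C1 half iy.
  case: (cell_cover 0 (coarse_sub SC Cz)) => /split3[i0 i1 i2].
  - exact: n0.
  - exact: n1.
  - exact: n2.
exists (cells i); first by exists i.
by have [_] := meet C (cells i) SC (Sc i); rewrite (_ : C `&` cells i = C)//; exact/setIidl.
Qed.

End Coarsest.

(** * The common face of the three cells: interior, of codimension 2 *)

Definition core : set 'rV[R]_n := [set x | Delta x /\ forall j, bs j x = m j].

Lemma core_cell : Sigma core.
Proof.
have Cc : core center by split; [exact: center_hypersimplex|exact: block_sum_center].
split; first by exists center.
exists (cells 0); first by exists 0.
(* On cell 0 the functional [y_2 - y_1] is a sum of two nonpositive terms, so it vanishes only where
   all [y_j] are 0. *)
exists (block_vec R g (0 + 2) + -1 *: block_vec R g (0 + 1)), (m (0 + 2) - m (0 + 1)).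
split=> [x [_ h2 h1]|].
  by rewrite -/(dot _ x) dotDl dotZl -!block_sum_dot /m; lra.
apply/seteqP; split=> x /=; rewrite -/(dot _ x) dotDl dotZl -!block_sum_dot.
  move=> [Dx bx]; rewrite -!/(bs _ _) !bx; split; last by lra.
  by split=> //; rewrite -/(bs _ _) bx.
move=> [[Dx h2 h1] E]; split=> // j.
have := hypersimplex_sum 0 (proj2 Dx); move: E; rewrite /bs /m => E s.
by have [->|->|->] := ord3_case 0 j; lra.
Qed.

Lemma core_interior : interior_cell Delta Sigma core.
Proof.
split; first exact: core_cell.
have Cc : core center by split; [exact: center_hypersimplex|exact: block_sum_center].
move=> /(_ _ Cc)[F [fF nF Fc]]; apply: nF; apply/seteqP; split; first exact: face_sub.
apply: (face_relint fF _ _ Fc) => //.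
by apply: hypersimplex_relint; [exact: center_open|exact: center_hypersimplex].
Qed.

Definition block_mx3 : 'M[R]_(n, 3) := \matrix_(l, j) (g l == j)%:R.

Lemma mul_block_mx3 x j : (x *m block_mx3) 0 j = bs j x.
Proof.
rewrite mxE /bs block_sum_dot; apply: eq_bigr => l _.
by rewrite !mxE mulrC.
Qed.

Lemma rank_block_mx3 : \rank block_mx3 = 3%N.
Proof.
rewrite -mxrank_tr; apply/eqP; rewrite -/(row_free _); apply/row_freeP.
(* The block indicators are orthogonal with squared norms [#|block g j|], which are nonzero;
   dividing by these gives the inverse. *)
exists (\matrix_(l, j) ((g l == j)%:R / #|block g j|%:R)).
apply/matrixP => i j; rewrite !mxE.
under eq_bigr do rewrite !mxE mulrA -natrM.
rewrite -mulr_suml -natr_sum; case: (eqVneq i j) => [->|ij].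
  rewrite (_ : (\sum_l (g l == j) * (g l == j) = #|block g j|)%N).
    by rewrite divff// gt_eqF// block_card_gt0.
  rewrite -sum1_card [RHS]big_mkcond/=; apply: eq_bigr => l _.
  by rewrite inE; case: (g l == j).
rewrite big1 ?mul0r// => l _; case: eqVneq => [->|//].
by rewrite (negPf ij).
Qed.

(** The core is cut out near [center] by the three independent block sums and has dimension [n - 3];
    the hypersimplex is cut out there by the total sum alone and has dimension [n - 1]. *)
Lemma core_codim2 : has_codim Delta core 2.
Proof.
have n3 : (3 <= n)%N by rewrite -rank_block_mx3; exact: rank_leq_row.
have Cc : core center by split; [exact: center_hypersimplex|exact: block_sum_center].
exists (n - 3)%N.
  rewrite -rank_block_mx3; apply: (has_dim_kernel Cc).
    move=> x [Dx bx]; apply/rowP => j; rewrite !mul_block_mx3 bx.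
    by rewrite block_sum_center.
  move=> v vM; have bv j : bs j v = 0 by rewrite -mul_block_mx3 vM mxE.
  have [|e e0 H] := @hypersimplex_open center v center_open center_hypersimplex.
    by rewrite (sum_block_sum g) big1.
  exists e => //; split; first by apply: H; rewrite lexx ltW.
  by move=> j; rewrite /bs block_sumD block_sumZ -!/(bs _ _) bv mulr0 addr0 block_sum_center.
have -> : (n - 3 + 2 = n - 1)%N by lia.
have <- : \rank (const_mx 1 : 'cV[R]_n) = 1%N.
  rewrite -mxrank_tr trmx_const rank_rV.
  suff -> : (const_mx 1 : 'rV[R]_n) != 0 by [].
  have l : 'I_n by exists 0%N; apply: leq_trans n3.
  by apply/eqP => /rowP/(_ l); rewrite !mxE => /eqP; rewrite oner_eq0.
have mulE (x : 'rV[R]_n) : x *m const_mx 1 = (\sum_l x 0 l)%:M.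
  apply/rowP => j; rewrite !mxE [j]ord1 eqxx mulr1n.
  by apply: eq_bigr => l _; rewrite mxE mulr1.
apply: (has_dim_kernel center_hypersimplex).
  by move=> x [_ xk]; rewrite !mulE xk (proj2 center_hypersimplex).
move=> v; rewrite mulE => /rowP/(_ 0); rewrite !mxE eqxx mulr1n => v0.
have [e e0 H] := hypersimplex_open center_open center_hypersimplex v0.
by exists e => //; apply: H; rewrite lexx ltW.
Qed.

Lemma card_range_cell : (range cells #= `I_3)%card.
Proof.
have -> : range cells = [set cells (inord i) | i in `I_3].
  apply/seteqP; split=> C.
    by move=> [i _ <-]; exists (i : nat) => /=; rewrite ?inord_val.
  by move=> [i _ <-]; exists (inord i).
apply: inj_card_eq => i j; rewrite !inE /= => i3 j3 E.
have := @cell_subset_eq (inord i) (inord j); rewrite E => /(_ (fun _ => id)) ij.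
by have := congr1 val ij; rewrite /= !inordK.
Qed.

Lemma three_split_cells :
  [/\ maximal_cells Sigma = range cells, three_split Delta Sigma
    & matroid_subdivision Delta Sigma].
Proof.
split; first exact: maximal_cells_Sigma.
- split.
  + split; [exact: Sigma_subdivision|exact: Sigma_nontrivial|exact: coarse_eq].
  + by rewrite maximal_cells_Sigma; exact: card_range_cell.
  + by exists core; [exact: core_interior|exact: core_codim2].
- split; first exact: Sigma_subdivision.
  by move=> C [C0 [_ [i _ <-] fC]]; exact: cell_face_matroid fC C0.
Qed.

End ThreeSplit.

(** * From a partition to block indices *)

Lemma three_split_of_partition (R : realType) (n k : nat) (A1 A2 A3 : {set 'I_n})
  (hA12 : A1 :&: A2 = finset.set0) (hA13 : A1 :&: A3 = finset.set0)
  (hA23 : A2 :&: A3 = finset.set0) (hA : A1 :|: A2 :|: A3 = [set: 'I_n]%SET)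
  (mu1 mu2 mu3 : nat) (hmu : (mu1 + mu2 + mu3 = k)%N)
  (hmu1 : (1 <= mu1 <= #|A1| - 1)%N) (hmu2 : (1 <= mu2 <= #|A2| - 1)%N)
  (hmu3 : (1 <= mu3 <= #|A3| - 1)%N) :
  let Delta := hypersimplex R n k in
  let P1 := [set x | [/\ Delta x, \sum_(i in A3) x 0 i <= mu3%:R
                                & \sum_(i in A2) x 0 i >= mu2%:R]] in
  let P2 := [set x | [/\ Delta x, \sum_(i in A1) x 0 i <= mu1%:R
                                & \sum_(i in A3) x 0 i >= mu3%:R]] in
  let P3 := [set x | [/\ Delta x, \sum_(i in A2) x 0 i <= mu2%:R
                                & \sum_(i in A1) x 0 i >= mu1%:R]] in
  let Sigma := face_complex [set P1; P2; P3] in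
  [/\ maximal_cells Sigma = [set P1; P2; P3], three_split Delta Sigma
    & matroid_subdivision Delta Sigma].
Proof.
move=> Delta P1 P2 P3 Sigma.
(* Labels 1, 2, 3 become indices 0, 1, 2, which matches [P1], [P2], [P3] with the cells 0, 1, 2. *)
pose g l : 'I_3 := if l \in A1 then 0 else if l \in A2 then 1 else 2.
pose mu (j : 'I_3) := nth 0%N [:: mu1; mu2; mu3] j.
have inA l : [/\ (l \in A1) = (g l == 0), (l \in A2) = (g l == 1) & (l \in A3) = (g l == 2)].
  have := finset.in_setT l; rewrite -hA; move/setP/(_ l): hA12; move/setP/(_ l): hA13.
  move/setP/(_ l): hA23; rewrite !inE /g.
  by case: (l \in A1); case: (l \in A2); case: (l \in A3).
have in1 l : (l \in A1) = (g l == 0) by case: (inA l).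
have in2 l : (l \in A2) = (g l == 1) by case: (inA l).
have in3 l : (l \in A3) = (g l == 2) by case: (inA l).
have b1 : block g 0 = A1 by apply/setP => l; rewrite inE in1.
have b2 : block g 1 = A2 by apply/setP => l; rewrite inE in2.
have b3 : block g 2 = A3 by apply/setP => l; rewrite inE in3.
have sum_mu : (\sum_j mu j)%N = k by rewrite !big_ord_recr big_ord0.
have mu_bounds j : (0 < mu j < #|block g j|)%N.
  have [m1 m2 m3] : [/\ mu 0 = mu1, mu 1 = mu2 & mu 2 = mu3] by [].
  by case: (ord3P j) => ->; rewrite ?b1 ?b2 ?b3 ?m1 ?m2 ?m3; lia.
have e1 : 0 + 1 = 1 :> 'I_3 by rewrite add0r.
have e2 : 0 + 2 = 2 :> 'I_3 by rewrite add0r.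
have e3 : 1 + 1 = 2 :> 'I_3 by apply/val_inj.
have e4 : 1 + 2 = 0 :> 'I_3 by apply/val_inj.
have e5 : 2 + 1 = 0 :> 'I_3 by apply/val_inj.
have e6 : 2 + 2 = 1 :> 'I_3 by apply/val_inj.
have P1E : cell k g mu 0 = P1.
  by rewrite /cell /P1 /block_sum e1 e2; apply/funext => x; rewrite /= !(eq_bigl _ _ in2) !(eq_bigl _ _ in3).
have P2E : cell k g mu 1 = P2.
  by rewrite /cell /P2 /block_sum e3 e4; apply/funext => x; rewrite /= !(eq_bigl _ _ in1) !(eq_bigl _ _ in3).
have P3E : cell k g mu 2 = P3.
  by rewrite /cell /P3 /block_sum e5 e6; apply/funext => x; rewrite /= !(eq_bigl _ _ in1) !(eq_bigl _ _ in2).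
have PE : [set P1; P2; P3] = range (cell (R := R) k g mu).
  rewrite -P1E -P2E -P3E; apply/seteqP; split=> C.
    by move=> [[->|->]|->]; [exists 0|exists 1|exists 2].
  by move=> [j _ <-]; case: (ord3P j) => ->; [left; left|left; right|right].
rewrite /Sigma PE; exact: three_split_cells.
Qed.

Theorem theorem6p5 (R : realType) (n k : nat) (hkn : (1 <= k < n)%N)
  (A1 A2 A3 : {set 'I_n})
  (hA12 : A1 :&: A2 = finset.set0) (hA13 : A1 :&: A3 = finset.set0)
  (hA23 : A2 :&: A3 = finset.set0)
  (hA : A1 :|: A2 :|: A3 = [set: 'I_n]%SET)
  (mu1 mu2 mu3 : nat) (hmu : (mu1 + mu2 + mu3 = k)%N)
  (hmu1 : (1 <= mu1 <= #|A1| - 1)%N)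
  (hmu2 : (1 <= mu2 <= #|A2| - 1)%N)
  (hmu3 : (1 <= mu3 <= #|A3| - 1)%N) :
  let Delta := hypersimplex R n k in
  let P1 := [set x | [/\ Delta x, \sum_(i in A3) x 0 i <= mu3%:R
                                & \sum_(i in A2) x 0 i >= mu2%:R]] in
  let P2 := [set x | [/\ Delta x, \sum_(i in A1) x 0 i <= mu1%:R
                                & \sum_(i in A3) x 0 i >= mu3%:R]] in
  let P3 := [set x | [/\ Delta x, \sum_(i in A2) x 0 i <= mu2%:R
                                & \sum_(i in A1) x 0 i >= mu1%:R]] in
  let Q1 := [set x | [/\ Delta x, \sum_(i in A3) x 0 i >= mu3%:R
                                & \sum_(i in A2) x 0 i <= mu2%:R]] in
  let Q2 := [set x | [/\ Delta x, \sum_(i in A1) x 0 i >= mu1%:R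
                                & \sum_(i in A3) x 0 i <= mu3%:R]] in
  let Q3 := [set x | [/\ Delta x, \sum_(i in A2) x 0 i >= mu2%:R
                                & \sum_(i in A1) x 0 i <= mu1%:R]] in
  let SigmaP := face_complex [set P1; P2; P3] in
  let SigmaQ := face_complex [set Q1; Q2; Q3] in
  [/\ maximal_cells SigmaP = [set P1; P2; P3],
      three_split Delta SigmaP
    & matroid_subdivision Delta SigmaP] /\
  [/\ maximal_cells SigmaQ = [set Q1; Q2; Q3],
      three_split Delta SigmaQ
    & matroid_subdivision Delta SigmaQ].
Proof.
move=> Delta P1 P2 P3 Q1 Q2 Q3 SigmaP SigmaQ.
split; first exact: three_split_of_partition.
(* Interchanging the roles of [A2] and [A3] turns [P1], [P2], [P3] into [Q1], [Q3], [Q2], so the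
   second subdivision is an instance of the first. *)
have QE : [set Q1; Q2; Q3] = [set Q1; Q3; Q2] by rewrite -!setUA [[set Q2] `|` _]setUC.
have swap (S T U : 'rV[R]_n -> Prop) : [set x | [/\ S x, T x & U x]] = [set x | [/\ S x, U x & T x]].
  by apply/seteqP; split=> x [].
rewrite /SigmaQ QE /Q1 /Q2 /Q3 [X in [set X; _; _]]swap [X in [set _; X; _]]swap [X in [set _; _; X]]swap.
apply: (@three_split_of_partition R n k A1 A3 A2) => //.
- by rewrite finset.setIC.
- by rewrite -finset.setUA [A3 :|: A2]finset.setUC finset.setUA.
- by rewrite -hmu; lia.
Qed.
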